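(* Let $n,m\ge 1$ be integers, let $\mu\ge 0$ be a real number, and let $N_1,\dots,N_m$ be $n\times n$ matrices. Consider the minimization problem $$ \min_E\Bigl\{f(E):=\Bigl\|I_n\otimes E+\bar E\otimes I_n-\sum_{j=1}^{m}\bar N_j\otimes N_j\Bigr\|_{\mathrm F}^2+\mu\,\bigl\|I_n\otimes E+\bar E\otimes I_n\bigr\|_{\mathrm F}^2\Bigr\}, $$ in either the complex case ($N_j\in\mathbb{C}^{n\times n}$ for all $j$, minimization over all $E\in\mathbb{C}^{n\times n}$) or the real case ($N_j\in\mathbb{R}^{n\times n}$ for all $j$, minimization over all $E\in\mathbb{R}^{n\times n}$). Then, in both cases, an optimal $E$ (a global minimizer of $f$) is given by $$ E_\star=\frac{1}{n(1+\mu)}\sum_{j=1}^m \operatorname{tr}(\bar N_j)\left[N_j-\frac{1}{2n}\operatorname{tr}(N_j)\, I_n\right]. $$ Moreover, in the real case the minimizer is unique, and in the complex case $E_\star$ is the minimizer with the smallest Frobenius norm, i.e. the unique element of smallest Frobenius norm in the set of all global minimizers of $f$ over $\mathbb{C}^{n\times n}$.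
   Context: $I_n$ is the $n\times n$ identity matrix, $\otimes$ is the matrix Kronecker product, $\bar M$ denotes the entrywise complex conjugate of a matrix $M$ (so $\bar M=M$ if $M$ is real), $\operatorname{tr}$ is the trace, and $\|\cdot\|_{\mathrm F}$ is the Frobenius norm. The matrices inside the norms in $f$ are $n^2\times n^2$. *)

(* Defs.v *)
From mathcomp Require Import all_boot all_order all_algebra all_character.
From mathcomp Require Import complex.

Set Implicit Arguments.
Unset Strict Implicit.
Unset Printing Implicit Defensive.

Import Order.TTheory GRing.Theory Num.Theory.

Local Open Scope ring_scope.
Local Open Scope complex_scope.

Lemma trowE (F : fieldType) (m p q : nat) (A : 'rV[F]_m) (B : 'M[F]_(p, q))
    (j : 'I_m) (k : 'I_p) (l : 'I_q) (t : 'I_(m * q)) :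
  t = (j * q + l)%N :> nat -> trow A B k t = A 0 j * B k l.
Proof.
elim: m A j t => [|m IH] A j t tE; first by case: j tE.
case: (splitP (t : 'I_(q + m * q))) => s ts.
  have -> : t = lshift (m * q) s by apply/val_inj.
  have j0 : j = 0 :> nat.
    case: (posnP j) => // j_gt0; have := ltn_ord s.
    by rewrite -ts tE ltnNge (leq_trans _ (leq_addr _ _)) // leq_pmull.
  have -> : l = s by apply/val_inj; rewrite /= -ts tE j0.
  rewrite /= row_mxEl !mxE; congr (A _ _ * _).
  by apply/val_inj; rewrite /= j0.
have -> : t = rshift q s by apply/val_inj.
have j_gt0 : (0 < j)%N.
  case: (posnP j) => // j0; have := ltn_ord l.
  by rewrite -[(l : nat)]add0n -(mul0n q) -j0 -tE ts ltnNge leq_addr.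
have jm : (j.-1 < m)%N by rewrite prednK // -ltnS ltn_ord.
rewrite /= row_mxEr (IH _ (Ordinal jm)) /=.
  rewrite mxE; congr (A _ _ * _); apply/val_inj.
  by rewrite /= add1n prednK.
apply/eqP; rewrite -(eqn_add2l q) -ts tE addnA -mulSn prednK //.
Qed.

(* [tprod], from the character theory library, is the Kronecker product in    *)
(* the usual ordering of row and column indices.                              *)
Lemma tprod_entry (F : fieldType) (m n p q : nat)
    (A : 'M[F]_(m, n)) (B : 'M[F]_(p, q))
    (i : 'I_m) (j : 'I_n) (k : 'I_p) (l : 'I_q)
    (s : 'I_(m * p)) (t : 'I_(n * q)) :
  s = (i * p + k)%N :> nat -> t = (j * q + l)%N :> nat ->
  tprod A B s t = A i j * B k l.
Proof.
elim: m A i s => [|m IH] A i s sE tE; first by case: i sE.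
case: (splitP (s : 'I_(p + m * p))) => r sr.
  have -> : s = lshift (m * p) r by apply/val_inj.
  have i0 : i = 0 :> nat.
    case: (posnP i) => // i_gt0; have := ltn_ord r.
    by rewrite -sr sE ltnNge (leq_trans _ (leq_addr _ _)) // leq_pmull.
  have -> : k = r by apply/val_inj; rewrite /= -sr sE i0.
  rewrite /= col_mxEu (trowE _ _ _ tE) mxE; congr (A _ _ * _).
  by apply/val_inj; rewrite /= i0.
have -> : s = rshift p r by apply/val_inj.
have i_gt0 : (0 < i)%N.
  case: (posnP i) => // i0; have := ltn_ord k.
  by rewrite -[(k : nat)]add0n -(mul0n p) -i0 -sE sr ltnNge leq_addr.
have im : (i.-1 < m)%N by rewrite prednK // -ltnS ltn_ord.
rewrite /= col_mxEd (IH _ (Ordinal im)) //=.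
  rewrite mxE; congr (A _ _ * _); apply/val_inj.
  by rewrite /= add1n prednK.
by apply/eqP; rewrite -(eqn_add2l p) -sr sE addnA -mulSn prednK.
Qed.

Section KroneckerFit.

Variable R : rcfType.

(* The modulus [Normc.normc] of a complex number is [R]-valued, unlike [`|_|]. *)
Definition frobenius_norm (p q : nat) (A : 'M[R[i]]_(p, q)) : R :=
  Num.sqrt (\sum_(i < p) \sum_(j < q) Normc.normc (A i j) ^+ 2).

Definition conj_mx (p q : nat) (A : 'M[R[i]]_(p, q)) : 'M[R[i]]_(p, q) :=
  map_mx conjc A.

Definition kron_sum (n : nat) (E : 'M[R[i]]_n) : 'M[R[i]]_(n * n) :=
  tprod 1%:M E + tprod (conj_mx E) 1%:M.

Definition objective (n m : nat) (mu : R) (N : 'I_m -> 'M[R[i]]_n)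
    (E : 'M[R[i]]_n) : R :=
  frobenius_norm
    (kron_sum E - \sum_(j < m) tprod (conj_mx (N j)) (N j)) ^+ 2
  + mu * frobenius_norm (kron_sum E) ^+ 2.

Definition E_star (n m : nat) (mu : R) (N : 'I_m -> 'M[R[i]]_n) : 'M[R[i]]_n :=
  (1 / (n%:R * (1 + mu%:C))) *:
    \sum_(j < m) \tr (conj_mx (N j)) *:
       (N j - (1 / (2 * n%:R) * \tr (N j)) *: 1%:M).

End KroneckerFit.

Definition is_argmin (R : rcfType) (T : Type) (S : T -> Prop) (g : T -> R)
    (x : T) : Prop :=
  S x /\ forall y, S y -> g x <= g y.

(* Main.v *)
Require Import Defs.
From mathcomp Require Import all_boot all_order all_algebra.
From mathcomp Require Import all_character.
From mathcomp Require Import complex reals.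
From mathcomp Require Import ring lra.

Set Implicit Arguments.
Unset Strict Implicit.
Unset Printing Implicit Defensive.

Import Order.TTheory GRing.Theory Num.Theory.

Local Open Scope ring_scope.

(** Let [K] denote [kron_sum], a real-linear map, and [P] the sum of the Kronecker
    products of [conj_mx (N j)] and [N j]. With respect to the real part [fdot] of
    the Hermitian inner product, whose norm is the Frobenius norm, the objective
    [|K E - P|^2 + mu |K E|^2] is a convex quadratic function of [E], so that [E]
    is a minimizer exactly when [(1 + mu) <K D, K E> = <K D, P>] for all [D].

    Kronecker products turn traces into products of traces, hence
      [<K E, K D> = 2 (n <E, D> + Re (tr E * tr D))]   ([fdot_kron_sum]),
      [<K D, P> = 2 <D, M>] with [M] the sum of the [conj (tr (N j)) *: N j]
                                                ([fdot_kron_sum_target]).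
    As [M] has a real trace, subtracting from [M] the multiple [tr M / (2 n)] of the
    identity and dividing by [n (1 + mu)] solves this equation: the result is
    [E_star] ([normal_equation]). Consequently
      [f (E_star + D) = f E_star + (1 + mu) |K D|^2]    ([objective_E_starD]),
    and the minimizers are the [E_star + D] with [K D = 0].

    Both uniqueness claims come from testing [K D = 0] through the first formula.
    Against the identity it gives [Re (tr D) = 0]; therefore [D] is orthogonal to
    every matrix with a real trace ([kron_sum_eq0_ortho]). Such a matrix is
    [E_star], so that [|E_star + D|^2 = |E_star|^2 + |D|^2] and [E_star] is the only
    minimizer of least norm. In the real case such a matrix is also [D], a
    difference of real matrices, so [D = 0]. *)

(** * Kronecker products *)

Lemma kron_index (m p : nat) (s : 'I_(m * p)) :
  exists i : 'I_m, exists k : 'I_p, s = (i * p + k)%N :> nat.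
Proof.
have p_gt0 : (0 < p)%N by case: p s => // s; case: s => s; rewrite muln0.
have im : (s %/ p < m)%N by rewrite ltn_divLR // ltn_ord.
by exists (Ordinal im), (Ordinal (ltn_pmod s p_gt0)); rewrite /= -divn_eq.
Qed.

Lemma tprodDl (F : fieldType) (m n p q : nat) (A A' : 'M[F]_(m, n))
    (B : 'M[F]_(p, q)) :
  tprod (A + A') B = tprod A B + tprod A' B.
Proof.
apply/matrixP=> s t; have [i [k sE]] := kron_index s.
have [j [l tE]] := kron_index t.
by rewrite mxE !(tprod_entry _ _ sE tE) mxE mulrDl.
Qed.

Lemma tprodDr (F : fieldType) (m n p q : nat) (A : 'M[F]_(m, n))
    (B B' : 'M[F]_(p, q)) :
  tprod A (B + B') = tprod A B + tprod A B'.
Proof.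
apply/matrixP=> s t; have [i [k sE]] := kron_index s.
have [j [l tE]] := kron_index t.
by rewrite mxE !(tprod_entry _ _ sE tE) mxE mulrDr.
Qed.

Lemma trmx_tprod (F : fieldType) (m n p q : nat) (A : 'M[F]_(m, n))
    (B : 'M[F]_(p, q)) :
  (tprod A B)^T = tprod A^T B^T.
Proof.
apply/matrixP=> s t; have [i [k sE]] := kron_index s.
have [j [l tE]] := kron_index t.
by rewrite mxE (tprod_entry _ _ sE tE) (tprod_entry _ _ tE sE) !mxE.
Qed.

Lemma map_tprod (F F' : fieldType) (f : {rmorphism F -> F'}) (m n p q : nat)
    (A : 'M[F]_(m, n)) (B : 'M[F]_(p, q)) :
  map_mx f (tprod A B) = tprod (map_mx f A) (map_mx f B).
Proof.
apply/matrixP=> s t; have [i [k sE]] := kron_index s.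
have [j [l tE]] := kron_index t.
by rewrite mxE !(tprod_entry _ _ sE tE) !mxE rmorphM.
Qed.

(** * Real parts, conjugation and real matrices *)

Lemma ReD (R : rcfType) (x y : R[i]) :
  complex.Re (x + y) = complex.Re x + complex.Re y.
Proof. by case: x; case: y. Qed.

Lemma Re_conjc (R : rcfType) (x : R[i]) : complex.Re (conjc x) = complex.Re x.
Proof. by case: x. Qed.

Lemma Re_sum (R : rcfType) (I : finType) (F : I -> R[i]) :
  complex.Re (\sum_k F k) = \sum_k complex.Re (F k).
Proof. exact: (big_morph (@complex.Re R) (@ReD R) (erefl _)). Qed.

Lemma ReZ (R : rcfType) (a : R) (x : R[i]) :
  complex.Re (a%:C%C * x) = a * complex.Re x.
Proof. by case: x => u v /=; rewrite mul0r subr0. Qed.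

Lemma conj_mxK (R : rcfType) (p q : nat) (A : 'M[R[i]]_(p, q)) :
  conj_mx (conj_mx A) = A.
Proof. by apply/matrixP=> i j; rewrite !mxE conjcK. Qed.

Lemma mxtrace_conj (R : rcfType) (n : nat) (A : 'M[R[i]]_n) :
  \tr (conj_mx A) = conjc (\tr A).
Proof. exact: trace_map_mx. Qed.

Lemma mxtrace_real (R : rcfType) (n : nat) (A : 'M[R[i]]_n) :
  A \is a mxOver Num.real -> exists t : R, \tr A = t%:C%C.
Proof.
move=> /mxOverP Ar; apply/complex_realP.
by apply: rpred_sum => k _; apply: Ar.
Qed.

Lemma mxOver_realB (R : rcfType) (p q : nat) (A B : 'M[R[i]]_(p, q)) :
  A \is a mxOver Num.real -> B \is a mxOver Num.real ->
  A - B \is a mxOver Num.real.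
Proof.
move=> /mxOverP Ar /mxOverP Br; apply/mxOverP=> k l.
by rewrite !mxE; apply: rpredB.
Qed.

(** * The real inner product underlying the Frobenius norm *)

(** The complex matrices form a Euclidean space over the real field: the map
    sending [E] to its Kronecker sum involves conjugation, so it is linear over
    the reals only, and orthogonality has to be taken with the real part. *)
Definition fdot (R : rcfType) (p q : nat) (A B : 'M[R[i]]_(p, q)) : R :=
  complex.Re (\tr ((conj_mx A)^T *m B)).

Lemma fdotDr (R : rcfType) (p q : nat) (A B C : 'M[R[i]]_(p, q)) :
  fdot A (B + C) = fdot A B + fdot A C.
Proof. by rewrite /fdot mulmxDr linearD /= ReD. Qed.

Lemma fdotC (R : rcfType) (p q : nat) (A B : 'M[R[i]]_(p, q)) :
  fdot A B = fdot B A.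
Proof.
rewrite /fdot -Re_conjc -trace_map_mx map_mxM -map_trmx /=.
rewrite -mxtrace_tr trmx_mul trmxK; congr (complex.Re (\tr (_ *m _))).
by apply/matrixP=> i j; rewrite !mxE conjcK.
Qed.

Lemma fdotDl (R : rcfType) (p q : nat) (A B C : 'M[R[i]]_(p, q)) :
  fdot (A + B) C = fdot A C + fdot B C.
Proof. by rewrite !(fdotC _ C) fdotDr. Qed.

Lemma fdotNr (R : rcfType) (p q : nat) (A B : 'M[R[i]]_(p, q)) :
  fdot A (- B) = - fdot A B.
Proof. by apply/eqP; rewrite -addr_eq0 -fdotDr addNr /fdot mulmx0 mxtrace0. Qed.

Lemma fdotNl (R : rcfType) (p q : nat) (A B : 'M[R[i]]_(p, q)) :
  fdot (- A) B = - fdot A B.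
Proof. by rewrite !(fdotC _ B) fdotNr. Qed.

Lemma fdot0r (R : rcfType) (p q : nat) (A : 'M[R[i]]_(p, q)) : fdot A 0 = 0.
Proof. by rewrite /fdot mulmx0 mxtrace0. Qed.

Lemma fdotZr (R : rcfType) (p q : nat) (a : R) (A B : 'M[R[i]]_(p, q)) :
  fdot A (a%:C%C *: B) = a * fdot A B.
Proof. by rewrite /fdot -scalemxAr mxtraceZ ReZ. Qed.

Lemma fdot_sumr (R : rcfType) (p q : nat) (I : finType) (A : 'M[R[i]]_(p, q))
    (F : I -> 'M[R[i]]_(p, q)) :
  fdot A (\sum_k F k) = \sum_k fdot A (F k).
Proof. exact: (big_morph (fdot A) (fdotDr A) (fdot0r A)). Qed.

Lemma fdot1r (R : rcfType) (n : nat) (D : 'M[R[i]]_n) :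
  fdot D 1%:M = complex.Re (\tr D).
Proof. by rewrite /fdot mulmx1 mxtrace_tr mxtrace_conj Re_conjc. Qed.

Lemma normc_sqr (R : rcfType) (z : R[i]) :
  Normc.normc z ^+ 2 = complex.Re (conjc z * z).
Proof.
case: z => a b /=; rewrite sqr_sqrtr ?addr_ge0 ?sqr_ge0 //.
by rewrite mulNr opprK !expr2.
Qed.

Lemma fdotxxE (R : rcfType) (p q : nat) (A : 'M[R[i]]_(p, q)) :
  fdot A A = \sum_(i < p) \sum_(j < q) Normc.normc (A i j) ^+ 2.
Proof.
rewrite /fdot /mxtrace Re_sum exchange_big; apply: eq_bigr => j _.
rewrite mxE Re_sum; apply: eq_bigr => i _.
by rewrite !mxE normc_sqr.
Qed.

Lemma fdot_ge0 (R : rcfType) (p q : nat) (A : 'M[R[i]]_(p, q)) : 0 <= fdot A A.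
Proof.
by rewrite fdotxxE; do 2![apply: sumr_ge0 => ? _]; rewrite sqr_ge0.
Qed.

Lemma fdot_eq0 (R : rcfType) (p q : nat) (A : 'M[R[i]]_(p, q)) :
  fdot A A = 0 -> A = 0.
Proof.
move=> A0; apply/matrixP=> i j; rewrite mxE.
apply: Normc.eq0_normc; apply/eqP; rewrite -sqrf_eq0; apply/eqP.
move: A0; rewrite fdotxxE => /psumr_eq0P/(_ i isT) A0.
have {A0}/psumr_eq0P A0 := A0 (fun k _ => sumr_ge0 _ (fun l _ => sqr_ge0 _)).
by apply: A0 => // k _; rewrite sqr_ge0.
Qed.

Lemma frobenius_sqr (R : rcfType) (p q : nat) (A : 'M[R[i]]_(p, q)) :
  frobenius_norm A ^+ 2 = fdot A A.
Proof. by rewrite /frobenius_norm -fdotxxE sqr_sqrtr ?fdot_ge0. Qed.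

Lemma frobenius_ge0 (R : rcfType) (p q : nat) (A : 'M[R[i]]_(p, q)) :
  0 <= frobenius_norm A.
Proof. exact: sqrtr_ge0. Qed.

(** The trace, the adjoint and the product all factor through Kronecker
    products; this is what reduces the n^2 x n^2 norms to n x n traces. *)
Lemma fdot_tprod (R : rcfType) (m n p q : nat) (A C : 'M[R[i]]_(m, n))
    (B D : 'M[R[i]]_(p, q)) :
  fdot (tprod A B) (tprod C D) =
  complex.Re (\tr ((conj_mx A)^T *m C) * \tr ((conj_mx B)^T *m D)).
Proof.
by rewrite /fdot /conj_mx map_tprod trmx_tprod -tprodE mxtrace_prod.
Qed.

(** * Gram formulas for Kronecker sums *)

Lemma kron_sumD (R : rcfType) (n : nat) (E D : 'M[R[i]]_n) :
  kron_sum (E + D) = kron_sum E + kron_sum D.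
Proof.
by rewrite /kron_sum /conj_mx map_mxD tprodDl tprodDr addrACA.
Qed.

(** Of the two summands of the Kronecker sum, the first contributes the product
    of the traces of [(conj_mx E)^T *m B] and [conj_mx A]. The second contributes
    a product of traces whose conjugate is the stated term. *)
Lemma fdot_kron_sum_tprod (R : rcfType) (n : nat) (E A B : 'M[R[i]]_n) :
  fdot (kron_sum E) (tprod (conj_mx A) B) =
  complex.Re (conjc (\tr A) * \tr ((conj_mx E)^T *m B))
  + complex.Re (conjc (\tr B) * \tr ((conj_mx E)^T *m A)).
Proof.
rewrite /kron_sum fdotDl !fdot_tprod conj_mxK; congr (_ + _).
  by rewrite /conj_mx map_mx1 trmx1 mul1mx trace_map_mx.
rewrite {2}/conj_mx map_mx1 trmx1 mul1mx -[LHS]Re_conjc rmorphM mulrC /=.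
congr (complex.Re (_ * _)).
by rewrite -mxtrace_conj /conj_mx map_mxM -map_trmx -!/(conj_mx _) conj_mxK.
Qed.

(** Both terms of [kron_sum D] have an identity factor, so the preceding formula
    applies to each of them. The cross terms give the trace term. It is
    bilinear rather than sesquilinear, hence negative when [E] and [D] are the same
    imaginary multiple of the identity, and it then cancels the first term. *)
Lemma fdot_kron_sum (R : rcfType) (n : nat) (E D : 'M[R[i]]_n) :
  fdot (kron_sum E) (kron_sum D) =
  2 * (n%:R * fdot E D + complex.Re (\tr E * \tr D)).
Proof.
have conj1 : conj_mx (1%:M : 'M[R[i]]_n) = 1%:M by exact: map_mx1.
have nC : n%:R = (n%:R : R)%:C%C :> R[i] by rewrite rmorph_nat.
have trE : \tr ((conj_mx E)^T) = conjc (\tr E).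
  by rewrite mxtrace_tr mxtrace_conj.
rewrite {2}/kron_sum fdotDr -{1}conj1 !fdot_kron_sum_tprod.
rewrite !mulmx1 trE mxtrace1 conjc_nat nC !ReZ -!rmorphM !Re_conjc.
rewrite [\tr D * _]mulrC -/(fdot E D); ring.
Qed.

(** * Kernel of the Kronecker sum *)

(** For positive [n] the kernel consists of the imaginary multiples of the
    identity. The results below avoid this description: each of them tests a
    kernel element against one well-chosen [X]. *)
Lemma kron_sum_eq0_fdot (R : rcfType) (n : nat) (X D : 'M[R[i]]_n) :
  kron_sum D = 0 -> n%:R * fdot X D + complex.Re (\tr X * \tr D) = 0.
Proof.
move=> D0; have := fdot_kron_sum X D; rewrite D0 fdot0r => /esym/eqP.
by rewrite mulf_eq0 pnatr_eq0 => /eqP.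
Qed.

(** Testing against the identity counts the real part of the trace twice, with the
    same sign. *)
Lemma kron_sum_eq0_trace (R : rcfType) (n : nat) (D : 'M[R[i]]_n) :
  (0 < n)%N -> kron_sum D = 0 -> complex.Re (\tr D) = 0.
Proof.
move=> n_gt0 /(@kron_sum_eq0_fdot _ _ 1%:M); rewrite fdotC fdot1r mxtrace1.
rewrite -(rmorph_nat (real_complex R)) ReZ -mulrDr -mulr2n => /eqP.
by rewrite mulf_eq0 pnatr_eq0 mulrn_eq0 eqn0Ngt n_gt0 => /eqP.
Qed.

(** With a real trace for [X], the trace term is a real multiple of the real part
    of the trace of [D], which vanishes on the kernel. *)
Lemma kron_sum_eq0_ortho (R : rcfType) (n : nat) (X D : 'M[R[i]]_n) (s : R) :
  (0 < n)%N -> kron_sum D = 0 -> \tr X = s%:C%C -> fdot X D = 0.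
Proof.
move=> n_gt0 D0 Xs; have := kron_sum_eq0_fdot X D0.
rewrite Xs ReZ kron_sum_eq0_trace // mulr0 addr0 => /eqP.
by rewrite mulf_eq0 pnatr_eq0 eqn0Ngt n_gt0 => /eqP.
Qed.

(** A real matrix in the kernel has real trace, so it is orthogonal to itself. *)
Lemma kron_sum_inj_real (R : rcfType) (n : nat) (D : 'M[R[i]]_n) :
  (0 < n)%N -> D \is a mxOver Num.real -> kron_sum D = 0 -> D = 0.
Proof.
move=> n_gt0 /mxtrace_real[t Dt] D0.
exact/fdot_eq0/(kron_sum_eq0_ortho n_gt0 D0 Dt).
Qed.

(** * The candidate solves the normal equation *)

(** The Riesz representative of the linear part of the objective, by
    [fdot_kron_sum_target]. *)
Definition trace_moment (R : rcfType) (n m : nat) (N : 'I_m -> 'M[R[i]]_n) :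
    'M[R[i]]_n :=
  \sum_(j < m) conjc (\tr (N j)) *: N j.

(** The trace is the sum of the squared moduli of the traces of the [N j]. *)
Lemma mxtrace_trace_moment (R : rcfType) (n m : nat) (N : 'I_m -> 'M[R[i]]_n) :
  exists t : R, \tr (trace_moment N) = t%:C%C.
Proof.
exists (\sum_(j < m) Normc.normc (\tr (N j)) ^+ 2).
rewrite /trace_moment raddf_sum rmorph_sum; apply: eq_bigr => j _ /=.
rewrite mxtraceZ normc_sqr.
case: (\tr (N j)) => a b; rewrite /GRing.mul /=.
by congr (_ +i* _)%C; ring.
Qed.

(** With equal factors [A] and [B], the two terms of the formula for a single
    Kronecker product coincide. *)
Lemma fdot_kron_sum_target (R : rcfType) (n m : nat) (N : 'I_m -> 'M[R[i]]_n)
    (D : 'M[R[i]]_n) :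
  fdot (kron_sum D) (\sum_(j < m) tprod (conj_mx (N j)) (N j)) =
  2 * fdot D (trace_moment N).
Proof.
rewrite !fdot_sumr mulr_sumr; apply: eq_bigr => j _.
by rewrite fdot_kron_sum_tprod -mulr2n mulr_natl /fdot -scalemxAr mxtraceZ.
Qed.

Lemma E_starE (R : rcfType) (n m : nat) (mu : R) (N : 'I_m -> 'M[R[i]]_n) :
  E_star mu N = ((n%:R * (1 + mu))^-1)%:C%C *:
    (trace_moment N - (((2 * n%:R)^-1)%:C%C * \tr (trace_moment N)) *: 1%:M).
Proof.
have nC : n%:R = (n%:R : R)%:C%C :> R[i] by rewrite rmorph_nat.
rewrite /E_star !div1r nC -[1 + _%:C%C]rmorphD -rmorphM -fmorphV /=.
congr (_ *: _).
rewrite /trace_moment raddf_sum /= mulr_sumr scaler_suml.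
rewrite -sumrB; apply: eq_bigr => j _.
rewrite mxtrace_conj scalerBr !scalerA mxtraceZ -[2]/(2%:R).
rewrite -[2%:R](rmorph_nat (real_complex R)) -rmorphM -fmorphV /=.
by congr (_ - _ *: _); ring.
Qed.

Lemma mxtrace_E_star (R : rcfType) (n m : nat) (mu : R)
    (N : 'I_m -> 'M[R[i]]_n) :
  exists s : R, \tr (E_star mu N) = s%:C%C.
Proof.
have [t tE] := mxtrace_trace_moment N.
exists ((n%:R * (1 + mu))^-1 * (t - (2 * n%:R)^-1 * (t * n%:R))).
rewrite E_starE mxtraceZ raddfB /= mxtraceZ mxtrace1 tE.
by rewrite !(rmorphM, rmorphB, rmorph_nat) /= mulrA.
Qed.

Lemma E_star_real (R : rcfType) (n m : nat) (mu : R) (N : 'I_m -> 'M[R[i]]_n) :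
  (forall j, N j \is a mxOver Num.real) -> E_star mu N \is a mxOver Num.real.
Proof.
move=> Nr.
have Cr (x : R) : x%:C%C \is @Num.real R[i] by apply/complex_realP; exists x.
have Mr : trace_moment N \is a mxOver Num.real.
  apply/mxOverP=> k l; rewrite summxE; apply: rpred_sum => j _; rewrite mxE.
  have [t ->] := mxtrace_real (Nr j).
  by rewrite conjc_real rpredM // (mxOverP (Nr j)).
have [t tE] := mxtrace_real Mr.
rewrite E_starE tE -rmorphM; apply/mxOverP=> k l; rewrite !mxE.
apply: rpredM; first exact: Cr.
apply: rpredB; first exact: (mxOverP Mr).
by apply: rpredM; [exact: Cr | exact: realn].
Qed.

(** By the Gram formula both sides are real inner products with [D] of explicit
    matrices. On the left, the trace term adds a multiple of the real part of the
    trace of [D]; the correction [1 / (2 n)] in [E_star] is chosen to cancel it,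
    which works because [trace_moment N] has a real trace. *)
Lemma normal_equation (R : rcfType) (n m : nat) (mu : R)
    (N : 'I_m -> 'M[R[i]]_n) (D : 'M[R[i]]_n) :
  (0 < n)%N -> 0 <= mu ->
  (1 + mu) * fdot (kron_sum D) (kron_sum (E_star mu N)) =
  fdot (kron_sum D) (\sum_(j < m) tprod (conj_mx (N j)) (N j)).
Proof.
move=> n_gt0 mu_ge0.
have n_neq0 : n%:R != 0 :> R by rewrite pnatr_eq0 -lt0n.
have mu_neq0 : 1 + mu != 0 by rewrite gt_eqF // ltr_pwDl.
have [t tE] := mxtrace_trace_moment N.
have nC : n%:R = (n%:R : R)%:C%C :> R[i] by rewrite rmorph_nat.
rewrite fdot_kron_sum fdot_kron_sum_target E_starE tE.
rewrite -rmorphM fdotZr fdotDr fdotNr fdotZr fdot1r.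
rewrite mxtraceZ raddfB /= !mxtraceZ mxtrace1 tE nC.
rewrite -!(rmorphM (real_complex R)) -rmorphB -(rmorphM (real_complex R)).
rewrite [\tr D * _]mulrC ReZ.
by field; rewrite n_neq0.
Qed.

(** * Minimizers of the objective *)

(** The objective is quadratic in the Kronecker sum of its argument, and its
    first-order variation at [E_star] vanishes by the normal equation. *)
Lemma objective_E_starD (R : rcfType) (n m : nat) (mu : R)
    (N : 'I_m -> 'M[R[i]]_n) (D : 'M[R[i]]_n) :
  (0 < n)%N -> 0 <= mu ->
  objective mu N (E_star mu N + D) =
  objective mu N (E_star mu N) + (1 + mu) * fdot (kron_sum D) (kron_sum D).
Proof.
move=> n_gt0 mu_ge0.
have := normal_equation N D n_gt0 mu_ge0.
rewrite /objective !frobenius_sqr kron_sumD.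
move: (kron_sum _) (kron_sum D) (\sum_(j < m) _) => K L P.
rewrite !(fdotDr, fdotDl, fdotNr, fdotNl) !(fdotC K L) !(fdotC P).
(* The goal is linear in the products of [mu] with the inner products. *)
by lra.
Qed.

Lemma E_star_min (R : rcfType) (n m : nat) (mu : R)
    (N : 'I_m -> 'M[R[i]]_n) (E : 'M[R[i]]_n) :
  (0 < n)%N -> 0 <= mu ->
  objective mu N (E_star mu N) <= objective mu N E.
Proof.
move=> n_gt0 mu_ge0; rewrite -[E](subrKC (E_star mu N)) objective_E_starD //.
by rewrite lerDl mulr_ge0 ?fdot_ge0 // addr_ge0.
Qed.

Lemma minimizer_kron_sum (R : rcfType) (n m : nat) (mu : R)
    (N : 'I_m -> 'M[R[i]]_n) (E : 'M[R[i]]_n) :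
  (0 < n)%N -> 0 <= mu ->
  objective mu N E <= objective mu N (E_star mu N) ->
  kron_sum (E - E_star mu N) = 0.
Proof.
move=> n_gt0 mu_ge0; rewrite -{1}[E](subrKC (E_star mu N)) objective_E_starD //.
rewrite gerDl pmulr_rle0 ?ltr_pwDl // => le0.
by apply/fdot_eq0/le_anti; rewrite le0 fdot_ge0.
Qed.

(** Pythagoras: the displacement from [E_star] to another minimizer lies in the
    kernel, and the real trace of [E_star] makes it orthogonal to that kernel. *)
Lemma fdot_minimizer (R : rcfType) (n m : nat) (mu : R)
    (N : 'I_m -> 'M[R[i]]_n) (E : 'M[R[i]]_n) :
  (0 < n)%N -> 0 <= mu ->
  objective mu N E <= objective mu N (E_star mu N) ->
  fdot E E = fdot (E_star mu N) (E_star mu N)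
             + fdot (E - E_star mu N) (E - E_star mu N).
Proof.
move=> n_gt0 mu_ge0 /(minimizer_kron_sum n_gt0 mu_ge0) D0.
have [s Es] := mxtrace_E_star mu N.
have ortho := kron_sum_eq0_ortho n_gt0 D0 Es.
rewrite -{1 2}[E](subrKC (E_star mu N)); move: (E - _) ortho => D ortho.
by rewrite fdotDl !fdotDr (fdotC D) ortho addr0 add0r.
Qed.

(* A real matrix is a complex matrix with real entries: in [R[i]], [Num.real] *)
(* is the set of the [z] with zero imaginary part.                            *)
Theorem theorem2p1 (R : realType) (n m : nat) (mu : R)
    (N : 'I_m -> 'M[R[i]]_n) :
  (0 < n)%N -> (0 < m)%N -> 0 <= mu ->
  let f := objective mu N in
  let Es := E_star mu N in
  let complex_minimizer := is_argmin (fun=> True) f in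
  let real_minimizer :=
    is_argmin (fun E : 'M[R[i]]_n => E \is a mxOver Num.real) f in
  (complex_minimizer Es
   /\ unique (is_argmin complex_minimizer (@frobenius_norm R n n)) Es)
  /\ ((forall j, N j \is a mxOver Num.real) ->
      real_minimizer Es /\ unique real_minimizer Es).
Proof.
move=> n_gt0 _ mu_ge0 f Es complex_minimizer real_minimizer.
have Es_min E : f Es <= f E by exact: E_star_min.
have Es_complex : complex_minimizer Es by [].
have pyth E : complex_minimizer E ->
    fdot E E = fdot Es Es + fdot (E - Es) (E - Es).
  by case=> _ /(_ Es I); apply: fdot_minimizer.
split.
  split=> //; split.
    split=> // E /pyth pythE.
    rewrite -(ler_pXn2r (ltn0Sn 1)) ?nnegrE ?frobenius_ge0 //.
    by rewrite !frobenius_sqr pythE lerDl fdot_ge0.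
  move=> E [/pyth pythE /(_ Es Es_complex)].
  rewrite -(ler_pXn2r (ltn0Sn 1)) ?nnegrE ?frobenius_ge0 //.
  rewrite !frobenius_sqr pythE gerDl => le0.
  by apply/esym/subr0_eq/fdot_eq0/le_anti; rewrite le0 fdot_ge0.
move=> N_real.
have Es_real : real_minimizer Es by split=> [|E _]; [exact: E_star_real|].
split=> //; split=> // E [E_real /(_ Es Es_real.1) fE_le].
apply/esym/subr0_eq/(kron_sum_inj_real n_gt0).
  exact: mxOver_realB Es_real.1.
exact: minimizer_kron_sum.
Qed.
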